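(* For all $n\ge 3$, the cylinder $\Sigma=\mathbb{R}^{n-1}\times S^1\subset\mathbb{R}^{n+1}$, where $S^1\subset\mathbb{R}^2$ is the unit circle, with the Riemannian metric induced by the Euclidean metric of $\mathbb{R}^{n+1}$, is conformally flat.
   Context: A hypersurface $\Sigma\subset\mathbb{R}^{n+1}$ ($n\ge3$) with induced metric given in local coordinates by $G(x)=(g_{ij})$, with inverse $(g^{ij})$, is called conformally flat if: when $n=3$, the Cotton tensor vanishes, $C_{ijk}=0$ for all $i,j,k$; when $n\ge4$, the Weyl conformal curvature tensor vanishes, $W_{ijkl}=0$ for all $i,j,k,l$. Here (summation convention) $R_{ijkl}$ are the components $R_m(\partial_i,\partial_j,\partial_k,\partial_l)$ of the Riemann curvature tensor $R_m(X,Y,Z,W)=\langle\nabla_X\nabla_YZ-\nabla_Y\nabla_XZ-\nabla_{[X,Y]}Z,W\rangle$, $R_{ij}=g^{\mu\nu}R_{\mu ij\nu}$, $R=g^{ij}R_{ij}$, $$W_{ijkl}=R_{ijkl}+\frac{1}{n-2}(g_{ki}R_{jl}-g_{il}R_{jk}+g_{jl}R_{ik}-g_{jk}R_{il})+\frac{1}{(n-1)(n-2)}(g_{il}g_{jk}-g_{ki}g_{jl})R,$$ $$S_{ij}=\frac{1}{n-2}\Big(R_{ij}-\frac{R}{2(n-1)}g_{ij}\Big),\qquad C_{ijk}=\nabla_jS_{ik}-\nabla_kS_{ij},$$ with $\nabla_jS_{ik}=\frac{\partial S_{ik}}{\partial x_j}-S_{mk}\Gamma^m_{ij}-S_{im}\Gamma^m_{kj}$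 and $\Gamma^m_{ij}=\frac12g^{km}(\partial_ig_{kj}+\partial_jg_{ki}-\partial_kg_{ij})$. *)

(* Defs.v *)
From HB Require Import structures.
From mathcomp Require Import all_boot all_order all_algebra.
From mathcomp Require Import all_classical all_reals all_analysis.
Set Implicit Arguments.
Unset Strict Implicit.
Unset Printing Implicit Defensive.
Import Order.TTheory GRing.Theory Num.Theory.
Import numFieldNormedType.Exports.
Local Open Scope classical_set_scope.
Local Open Scope ring_scope.

Definition partial (R : realType) (n : nat) (V : normedModType R) (i : 'I_n)
    (f : 'rV[R]_n -> V) : 'rV[R]_n -> V :=
  fun x => 'D_('e_i) f x.

(* C^oo on U: every iterated partial derivative exists and is (Frechet)
   differentiable on U; in particular all of them are continuous on U. *)
Definition smooth_on (R : realType) (n : nat) (V : normedModType R)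
    (U : set 'rV[R]_n) (f : 'rV[R]_n -> V) : Prop :=
  forall s : seq 'I_n,
    forall x, U x -> differentiable (foldr (@partial R n V) f s) x.

Definition dot (R : realType) (m : nat) (u v : 'rV[R]_m) : R :=
  \sum_k u 0 k * v 0 k.

(* A local parametrization phi : U -> Sigma of an embedded n-dimensional
   submanifold of R^(n+1).  The last clause says that phi is open from U to
   Sigma with its subspace topology, so that phi is a homeomorphism of U onto
   a relatively open part of Sigma. *)
Record local_param (R : realType) (n : nat) (Sigma : set 'rV[R]_n.+1)
    (U : set 'rV[R]_n) (phi : 'rV[R]_n -> 'rV[R]_n.+1) : Prop := LocalParam {
  lp_open : open U;
  lp_smooth : smooth_on U phi;
  lp_sub : phi @` U `<=` Sigma;
  lp_immersion : forall x, U x -> row_free ('J phi x);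
  lp_inj : {in U &, injective phi};
  lp_homeo : forall V : set 'rV[R]_n, open V -> V `<=` U ->
    exists2 W : set 'rV[R]_n.+1, open W & phi @` V = Sigma `&` W
}.

Definition hypersurface (R : realType) (n : nat) (Sigma : set 'rV[R]_n.+1)
    : Prop :=
  forall p, Sigma p ->
    exists U phi, local_param Sigma U phi /\ (phi @` U) p.

Definition induced_metric (R : realType) (n : nat)
    (phi : 'rV[R]_n -> 'rV[R]_n.+1) : 'rV[R]_n -> 'M[R]_n :=
  fun x => \matrix_(i, j) dot (partial i phi x) (partial j phi x).

(* Below, a metric on a coordinate domain is the matrix-valued function
   g = (g_ij), and a vector field X is the row X x = (X^1(x), ..., X^n(x)) of
   its components in the coordinate frame. *)

(* christoffel g m i j is Gamma^m_ij. *)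
Definition christoffel (R : realType) (n : nat) (g : 'rV[R]_n -> 'M[R]_n)
    (m i j : 'I_n) (x : 'rV[R]_n) : R :=
  2^-1 * \sum_k invmx (g x) k m *
    (partial i (fun y => g y k j) x + partial j (fun y => g y k i) x
     - partial k (fun y => g y i j) x).

(* nabla g X Y is the Levi-Civita derivative of Y along X. *)
Definition nabla (R : realType) (n : nat) (g : 'rV[R]_n -> 'M[R]_n)
    (X Y : 'rV[R]_n -> 'rV[R]_n) : 'rV[R]_n -> 'rV[R]_n :=
  fun x => \row_m \sum_i X x 0 i *
    (partial i (fun y => Y y 0 m) x + \sum_j christoffel g m i j x * Y x 0 j).

Definition lie_bracket (R : realType) (n : nat)
    (X Y : 'rV[R]_n -> 'rV[R]_n) : 'rV[R]_n -> 'rV[R]_n :=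
  fun x => \row_m \sum_i (X x 0 i * partial i (fun y => Y y 0 m) x
                          - Y x 0 i * partial i (fun y => X y 0 m) x).

Definition curvature (R : realType) (n : nat) (g : 'rV[R]_n -> 'M[R]_n)
    (X Y Z W : 'rV[R]_n -> 'rV[R]_n) (x : 'rV[R]_n) : R :=
  let V := nabla g X (nabla g Y Z) x - nabla g Y (nabla g X Z) x
           - nabla g (lie_bracket X Y) Z x in
  \sum_k \sum_l g x k l * V 0 k * W x 0 l.

Definition coord_field (R : realType) (n : nat) (i : 'I_n)
    : 'rV[R]_n -> 'rV[R]_n :=
  fun=> 'e_i.

Definition riemann (R : realType) (n : nat) (g : 'rV[R]_n -> 'M[R]_n)
    (i j k l : 'I_n) (x : 'rV[R]_n) : R :=
  curvature g (coord_field i) (coord_field j)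
              (coord_field k) (coord_field l) x.

Definition ricci (R : realType) (n : nat) (g : 'rV[R]_n -> 'M[R]_n)
    (i j : 'I_n) (x : 'rV[R]_n) : R :=
  \sum_mu \sum_nu invmx (g x) mu nu * riemann g mu i j nu x.

Definition scalar_curvature (R : realType) (n : nat)
    (g : 'rV[R]_n -> 'M[R]_n) (x : 'rV[R]_n) : R :=
  \sum_i \sum_j invmx (g x) i j * ricci g i j x.

Definition weyl (R : realType) (n : nat) (g : 'rV[R]_n -> 'M[R]_n)
    (i j k l : 'I_n) (x : 'rV[R]_n) : R :=
  riemann g i j k l x
  + (n%:R - 2)^-1 * (g x k i * ricci g j l x - g x i l * ricci g j k x
                     + g x j l * ricci g i k x - g x j k * ricci g i l x)
  + ((n%:R - 1) * (n%:R - 2))^-1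
    * (g x i l * g x j k - g x k i * g x j l) * scalar_curvature g x.

Definition schouten (R : realType) (n : nat) (g : 'rV[R]_n -> 'M[R]_n)
    (i j : 'I_n) (x : 'rV[R]_n) : R :=
  (n%:R - 2)^-1 *
  (ricci g i j x - scalar_curvature g x / (2 * (n%:R - 1)) * g x i j).

(* nabla_schouten g j i k is nabla_j S_ik. *)
Definition nabla_schouten (R : realType) (n : nat) (g : 'rV[R]_n -> 'M[R]_n)
    (j i k : 'I_n) (x : 'rV[R]_n) : R :=
  partial j (schouten g i k) x
  - \sum_m schouten g m k x * christoffel g m i j x
  - \sum_m schouten g i m x * christoffel g m k j x.

Definition cotton (R : realType) (n : nat) (g : 'rV[R]_n -> 'M[R]_n)
    (i j k : 'I_n) (x : 'rV[R]_n) : R :=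
  nabla_schouten g j i k x - nabla_schouten g k i j x.

(* Only meaningful for n >= 3. *)
Definition conformally_flat (R : realType) (n : nat)
    (Sigma : set 'rV[R]_n.+1) : Prop :=
  hypersurface Sigma /\
  forall U phi, local_param Sigma U phi -> forall x, U x ->
    (n = 3%N -> forall i j k, cotton (induced_metric phi) i j k x = 0) /\
    ((4 <= n)%N -> forall i j k l, weyl (induced_metric phi) i j k l x = 0).

Definition unit_circle (R : realType) : set 'rV[R]_2 :=
  [set z | z 0 0 ^+ 2 + z 0 1 ^+ 2 = 1].

(* R^(n-1) x S^1 as a subset of R^(n+1): the first n-1 coordinates are free,
   the last two (of indices n-1 and n) form a point of the unit circle. *)
Definition cylinder (R : realType) (n : nat) : set 'rV[R]_n.+1 :=
  [set p | unit_circle (\row_(j < 2) p 0 (inord (n.-1 + j)))].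
Arguments cylinder : clear implicits.

(* Main.v *)
Require Import Defs.
From mathcomp Require Import all_boot all_order all_algebra.
From mathcomp Require Import all_classical all_reals all_analysis.
From mathcomp Require Import perm ring lra.

(** The cylinder is flat, so that every curvature tensor built from its metric
vanishes; the proof has to establish this for an arbitrary local
parametrization [phi] of the cylinder, and to show that the cylinder is a
hypersurface.

Let [phi = (y_0, ..., y_(n-2), z_0, z_1)], where [z_0 ^ 2 + z_1 ^ 2 = 1]. The
forms [dy_0, ..., dy_(n-2)] and the angular form [z_0 dz_1 - z_1 dz_0] are
closed, and the induced metric is the sum of their squares: the matrix [E] of
their components satisfies [g = E E^T] ([cylinder_metricE]), is invertible
because [phi] is an immersion ([cylinder_coframe_unit]), and
[d_i E_ja = d_j E_ia] ([cylinder_coframe_closed]). The angular form is closed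
because both [dz_0] and [dz_1] are multiples of it. No angle function is
needed.

A metric with such a coframe is flat ([riemann_closed_coframe]). Closedness
reduces the lowered Christoffel symbols to [(d_i E) E^T], so that the matrix of
the connection in the direction [i] is [G_i = (d_i E) E^-1]. Differentiating
[G_j E = d_j E] gives [(d_i G_j + G_j G_i) E = d_i d_j E], whose right-hand side
is symmetric in [i] and [j] by Clairaut's theorem ([partial_comm]); the
antisymmetric part of the left-hand side is the curvature. Hence the Ricci and
scalar curvatures vanish, and with them the Weyl tensor, the Schouten tensor
and the Cotton tensor.

That the cylinder is a hypersurface is shown with the charts [cyl_chart]: the
last coordinate is the angle in [(- pi / 2, pi / 2)] measured from a given
point of the circle, and is recovered with the arcsine. *)

Set Implicit Arguments.
Unset Strict Implicit.
Unset Printing Implicit Defensive.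
Import Order.TTheory GRing.Theory Num.Theory.
Import numFieldNormedType.Exports.
Local Open Scope classical_set_scope.
Local Open Scope ring_scope.

(** * Clairaut's theorem *)

Section Clairaut.
Context {R : realType} {V : normedModType R}.
Implicit Types (f : V -> R) (x u v : V).

Lemma is_derive_line f x v (t : R) :
  derivable f (x + t *: v) v ->
  is_derive t 1 (fun s : R => f (x + s *: v)) ('D_v f (x + t *: v)).
Proof.
move=> df; have E : (fun h : R => h^-1 *:
    (((fun s : R => f (x + s *: v)) \o shift t) (h *: 1) - f (x + t *: v))) =
    (fun h : R => h^-1 *: ((f \o shift (x + t *: v)) (h *: v)
      - f (x + t *: v))).
  apply/funext => h /=; congr (_ *: (f _ - _)).
  by rewrite [_%:A]mulr1 scalerDl addrCA.
by split; rewrite /derivable /derive E.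
Qed.

Lemma MVT_line f x v (h : R) : 0 < h ->
  (forall t, 0 <= t <= h -> derivable f (x + t *: v) v) ->
  exists2 c, 0 <= c <= h & f (x + h *: v) - f x = h * 'D_v f (x + c *: v).
Proof.
move=> h0 df.
have dg t : 0 <= t <= h ->
    is_derive t 1 (fun s : R => f (x + s *: v)) ('D_v f (x + t *: v)).
  by move=> /df; exact: is_derive_line.
have [||c ch] := @MVT R (fun s : R => f (x + s *: v))
  (fun s : R => 'D_v f (x + s *: v)) 0 h h0.
- by move=> t; rewrite in_itv/= => /andP[t0 th]; apply: dg; rewrite !ltW.
- apply: derivable_within_continuous => t; rewrite in_itv/= => tI.
  by have [] := dg _ tI.
rewrite scale0r addr0 subr0 => E; exists c; last by rewrite E mulrC.
by move: ch; rewrite in_itv/= => /andP[/ltW -> /ltW ->].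
Qed.

(** Two applications of the mean value theorem, first along [v] to
[y |-> f (y + h u) - f y] and then along [u]. *)
Lemma second_difference f x u v (h : R) : 0 < h ->
  (forall s t, 0 <= s <= h -> 0 <= t <= h ->
     derivable f (x + s *: v + t *: u) v) ->
  (forall s t, 0 <= s <= h -> 0 <= t <= h ->
     derivable ('D_v f) (x + s *: v + t *: u) u) ->
  exists s t, [/\ 0 <= s <= h, 0 <= t <= h &
    f (x + h *: v + h *: u) - f (x + h *: v) - f (x + h *: u) + f x =
    h ^+ 2 * 'D_u ('D_v f) (x + s *: v + t *: u)].
Proof.
move=> h0 df ddf.
have hh : 0 <= h <= h by rewrite lexx ltW.
have h00 : 0 <= (0 : R) <= h by rewrite lexx ltW.
pose F := (f \o shift (h *: u)) - f.
have dF s : 0 <= s <= h ->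
    is_derive (x + s *: v) v F
      ('D_v f (x + s *: v + h *: u) - 'D_v f (x + s *: v)).
  move=> sh; apply: is_deriveB.
    have /derivableP := df s h sh hh; move=> [d1 d2].
    have E : (fun k : R => k^-1 *: (((f \o shift (h *: u)) \o shift (x + s *: v))
        (k *: v) - (f \o shift (h *: u)) (x + s *: v))) =
      (fun k : R => k^-1 *: ((f \o shift (x + s *: v + h *: u)) (k *: v)
        - f (x + s *: v + h *: u))).
      by apply/funext => k /=; rewrite !addrA.
    by split; rewrite /derivable /derive E.
  by apply/derivableP; have := df s 0 sh h00; rewrite scale0r addr0.
have [|s sh] := @MVT_line F x v h h0; first by move=> t /dF[].
have -> := @derive_val _ _ _ _ _ _ _ (dF s sh).
have [|t th ->] := @MVT_line ('D_v f) (x + s *: v) u h h0.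
  by move=> t th; exact: ddf.
move=> E; exists s, t; split => //.
rewrite expr2 -mulrA -E /F /= !fctE /=; ring.
Qed.

(** Clairaut's theorem. The second difference is symmetric in [u] and [v], and
is [h ^ 2] times a value of either mixed derivative near [x]. *)
Lemma derive_comm f x u v :
  (\forall y \near x, [/\ derivable f y u, derivable f y v,
     derivable ('D_v f) y u & derivable ('D_u f) y v]) ->
  {for x, continuous ('D_u ('D_v f))} ->
  {for x, continuous ('D_v ('D_u f))} ->
  'D_u ('D_v f) x = 'D_v ('D_u f) x.
Proof.
move=> near_df cuv cvu; apply/eqP; apply: contrapT => /negP neq.
set a := 'D_u ('D_v f) x in neq; set b := 'D_v ('D_u f) x in neq.
pose e := `|a - b| / 2.
have e0 : 0 < e by rewrite divr_gt0// normr_gt0 subr_eq0.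
have absurd_close (p q : R) : `|a - p| < e -> `|b - q| < e -> p <> q.
  move=> ap bq pq; have : `|a - b| < e + e.
    rewrite -[a - b](subrKA p) (le_lt_trans (ler_normD _ _))// ltrD//.
    by rewrite pq distrC.
  by rewrite -splitr ltxx.
have nuv : \forall y \near x, `|a - 'D_u ('D_v f) y| < e.
  by have /cvgrPdist_lt/(_ e e0) := cuv.
have nvu : \forall y \near x, `|b - 'D_v ('D_u f) y| < e.
  by have /cvgrPdist_lt/(_ e e0) := cvu.
have [d /= d0 dP] :=
  (nbhs_ballP x _).1 (filterI near_df (filterI nuv nvu)).
(* [h] is chosen so that the parallelogram on [h u] and [h v] lies in the ball *)
pose k := `|u| + `|v| + 1.
have k0 : 0 < k by rewrite ltr_wpDl// addr_ge0.
pose h := d / 2 / k.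
have h0 : 0 < h by rewrite !divr_gt0.
have inball s t : 0 <= s <= h -> 0 <= t <= h ->
    ball x d (x + s *: v + t *: u).
  move=> /andP[s0 sh] /andP[t0 th].
  rewrite -ball_normE /ball_/= -addrA opprD addNKr normrN.
  rewrite (le_lt_trans (ler_normD _ _))// !normrZ !ger0_norm//.
  rewrite (@le_lt_trans _ _ (h * k))//; last by rewrite /h divfK ?gt_eqF//; lra.
  have := normr_ge0 u; have := normr_ge0 v; rewrite /k; nra.
have inball' s t : 0 <= s <= h -> 0 <= t <= h ->
    ball x d (x + s *: u + t *: v).
  by move=> sh th; rewrite addrAC; exact: inball.
have [||s [t [sh th Ea]]] := @second_difference f x u v h h0.
- by move=> s t sh th; have [[]] := dP _ (inball s t sh th).
- by move=> s t sh th; have [[]] := dP _ (inball s t sh th).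
have [||s' [t' [sh' th' Eb]]] := @second_difference f x v u h h0.
- by move=> s' t' sh' th'; have [[]] := dP _ (inball' s' t' sh' th').
- by move=> s' t' sh' th'; have [[]] := dP _ (inball' s' t' sh' th').
have [_ [na _]] := dP _ (inball _ _ sh th).
have [_ [_ nb]] := dP _ (inball' _ _ sh' th').
have h20 : h ^+ 2 != 0 by rewrite expf_neq0// gt_eqF.
apply: (absurd_close _ _ na nb); apply: (mulfI h20).
apply: etrans (esym Ea) (etrans _ Eb).
by rewrite (addrAC x (h *: u)) (addrAC (f _) (- f (x + h *: v))).
Qed.

End Clairaut.

(** * Smooth functions on an open set *)

Lemma near_eq_differentiable (R : realType) (V W : normedModType R)
    (f g : V -> W) (x : V) :
  {near x, f =1 g} -> differentiable f x -> differentiable g x.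
Proof.
move=> fg dfx; have [cdf fE] := (diff_locallyP _ _).1 dfx.
have E : g \o shift x = cst (g x) + 'd f x +o_ (0 : V) id.
  apply/eqaddoP => _/posnumP[e].
  have /eqaddoP/(_ e%:num)/(_ [gt0 of e%:num]) := fE.
  have fg0 : \forall h \near (0 : V), f (h + x) = g (h + x).
    by move: fg; rewrite (near_shift 0 x) subr0.
  apply: filter_app; apply: filterS fg0 => h fgh.
  by rewrite !fctE /= fgh (nbhs_singleton fg).
by apply/diff_locallyP; rewrite (diff_unique cdf E).
Qed.

Section SmoothOn.
Context {R : realType} {n : nat}.
Variables (U : set 'rV[R]_n) (oU : open U).

Lemma near_open (x : 'rV[R]_n) (P : 'rV[R]_n -> Prop) :
  U x -> (forall y, U y -> P y) -> \forall y \near x, P y.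
Proof.
by move=> Ux PU; apply: filterS (open_nbhs_nbhs (conj oU Ux)).
Qed.

Section NormedMod.
Context {V : normedModType R}.
Implicit Types (f g : 'rV[R]_n -> V) (s : seq 'I_n) (i : 'I_n).

Lemma partial_congr f g i : {in U, f =1 g} ->
  {in U, partial i f =1 partial i g}.
Proof.
move=> fg x /set_mem Ux; apply: near_eq_derive.
by apply: (near_open Ux) => y Uy; apply: fg; rewrite inE.
Qed.

Lemma foldr_partial_congr f g s : {in U, f =1 g} ->
  {in U, foldr (@partial R n V) f s =1 foldr (@partial R n V) g s}.
Proof. by move=> fg; elim: s => //= i s; exact: partial_congr. Qed.

Lemma differentiable_congr f g x : U x -> {in U, f =1 g} ->
  differentiable f x -> differentiable g x.
Proof.
move=> Ux fg; apply: near_eq_differentiable.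
by apply: (near_open Ux) => y Uy; apply: fg; rewrite inE.
Qed.

Lemma smooth_on_congr f g : {in U, f =1 g} -> smooth_on U f -> smooth_on U g.
Proof.
move=> fg sf s x Ux; apply: differentiable_congr Ux _ (sf s x Ux).
exact: foldr_partial_congr.
Qed.

Lemma smooth_on_partial f i : smooth_on U f -> smooth_on U (partial i f).
Proof. by move=> sf s; rewrite -foldr_rcons; exact: sf. Qed.

Lemma smooth_on_differentiable f x : smooth_on U f -> U x -> differentiable f x.
Proof. by move=> sf; exact: (sf [::]). Qed.

Lemma smooth_on_derivable f x v : smooth_on U f -> U x -> derivable f x v.
Proof. by move=> sf Ux; exact/diff_derivable/smooth_on_differentiable. Qed.

(** Coinduction for smoothness: a class of functions differentiable on [U] and
closed, up to equality on [U], under partial derivatives is made of smooth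
functions. *)
Lemma smooth_on_coind (C : ('rV[R]_n -> V) -> Prop) :
  (forall f x, C f -> U x -> differentiable f x) ->
  (forall f i, C f -> exists2 g, C g & {in U, partial i f =1 g}) ->
  forall f, C f -> smooth_on U f.
Proof.
move=> Cdiff Cpartial f Cf s.
have [g Cg fg] : exists2 g, C g & {in U, foldr (@partial R n V) f s =1 g}.
  elim: s => [|i s [g Cg fg]] /=; first by exists f.
  have [h Ch gh] := Cpartial g i Cg; exists h => // x xU.
  by rewrite (partial_congr i fg xU) gh.
move=> x Ux; apply: (differentiable_congr Ux (f := g)); last exact: Cdiff.
by move=> y yU; rewrite fg.
Qed.

Lemma smooth_onD f g : smooth_on U f -> smooth_on U g -> smooth_on U (f + g).
Proof.
move=> sf sg; pose C h :=
  exists a b, [/\ smooth_on U a, smooth_on U b & h = a + b :> (_ -> V)].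
apply: (@smooth_on_coind C); last by exists f, g.
  move=> _ x [a [b [sa sb ->]]] Ux.
  by apply: differentiableD; exact: smooth_on_differentiable.
move=> _ i [a [b [sa sb ->]]]; exists (partial i a + partial i b).
  by exists (partial i a), (partial i b); split => //; exact: smooth_on_partial.
move=> x /set_mem Ux.
by rewrite /partial deriveD//; exact: smooth_on_derivable.
Qed.

Lemma smooth_onN f : smooth_on U f -> smooth_on U (- f).
Proof.
move=> sf; pose C h := exists2 a, smooth_on U a & h = - a :> (_ -> V).
apply: (@smooth_on_coind C); last by exists f.
  move=> _ x [a sa ->] Ux.
  by apply: differentiableN; exact: smooth_on_differentiable.
move=> _ i [a sa ->]; exists (- partial i a).
  by exists (partial i a) => //; exact: smooth_on_partial.
move=> x /set_mem Ux.
by rewrite /partial deriveN//; exact: smooth_on_derivable.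
Qed.

End NormedMod.

Lemma smooth_on_coord p q (f : 'rV[R]_n -> 'M[R]_(p, q)) a b :
  smooth_on U f -> smooth_on U (fun x => f x a b : R).
Proof.
move=> sf s x Ux.
have E : {in U, (fun x => foldr (@partial R n _) f s x a b : R) =1
    foldr (@partial R n R) (fun x => f x a b) s}.
  elim: s => //= i s IH y yU.
  rewrite -(partial_congr i IH yU) /partial derive_mx ?mxE//.
  by apply/diff_derivable/sf/set_mem.
apply: (differentiable_congr Ux E).
apply: (differentiable_comp (g := fun M : 'M[R]_(p, q) => M a b)).
  exact: sf.
exact: differentiable_coord.
Qed.

Implicit Types f g : 'rV[R]_n -> R.

Lemma partialM f g i x : smooth_on U f -> smooth_on U g -> U x ->
  partial i (f * g) x = f x * partial i g x + g x * partial i f x.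
Proof.
by move=> sf sg Ux; rewrite /partial deriveM//; exact: smooth_on_derivable.
Qed.

(** Finite sums of products of smooth functions; the Leibniz rule makes this
class stable under partial derivatives. *)
Inductive sum_of_products : ('rV[R]_n -> R) -> Prop :=
| SumOfProducts_prod f g :
    smooth_on U f -> smooth_on U g -> sum_of_products (f * g)
| SumOfProducts_add f g :
    sum_of_products f -> sum_of_products g -> sum_of_products (f + g).

Lemma smooth_onM f g : smooth_on U f -> smooth_on U g -> smooth_on U (f * g).
Proof.
have dC h x : sum_of_products h -> U x -> differentiable h x.
  move=> Ch Ux; elim: Ch => {h} h k sh sk; last first.
    by move=> _; exact: differentiableD.
  by apply: differentiableM; exact: smooth_on_differentiable.
move=> sf sg; apply: (smooth_on_coind dC);
  last exact: (SumOfProducts_prod sf sg).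
move=> {sf sg f g} f i; elim=> {f}
  [h k sh sk|h k Ch [h' Ch' hh'] Ck [k' Ck' kk']].
  exists (h * partial i k + k * partial i h).
    by apply: SumOfProducts_add; apply: SumOfProducts_prod => //;
      exact: smooth_on_partial.
  by move=> x /set_mem Ux; rewrite partialM.
exists (h' + k'); first exact: SumOfProducts_add.
move=> x xU; rewrite /partial deriveD; last 2 first.
- by apply/diff_derivable/dC => //; exact: set_mem.
- by apply/diff_derivable/dC => //; exact: set_mem.
by rewrite fctE -hh'// -kk'.
Qed.

Lemma partial_comm f i j x : smooth_on U f -> U x ->
  partial i (partial j f) x = partial j (partial i f) x.
Proof.
move=> sf Ux; apply: derive_comm.
- apply: (near_open Ux) => y Uy.
  by split; apply: smooth_on_derivable => //; exact: smooth_on_partial.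
- apply/differentiable_continuous/(smooth_on_differentiable _ Ux).
  exact/smooth_on_partial/smooth_on_partial.
- apply/differentiable_continuous/(smooth_on_differentiable _ Ux).
  exact/smooth_on_partial/smooth_on_partial.
Qed.

End SmoothOn.

(** * Derivatives of matrix-valued functions *)

Section MatrixDerivatives.
Context {R : realType} {V : normedModType R}.
Implicit Types (x v : V).

Lemma derivable_bigsum (I : Type) (r : seq I) (P : pred I)
    (F : I -> V -> R) x v :
  (forall i, P i -> derivable (F i) x v) ->
  derivable (\sum_(i <- r | P i) F i) x v.
Proof.
move=> dF; apply: (big_ind (fun f => derivable f x v)) => //.
by move=> f g; exact: derivableD.
Qed.

Lemma derivable_bigprod (I : Type) (r : seq I) (P : pred I)
    (F : I -> V -> R) x v :
  (forall i, P i -> derivable (F i) x v) ->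
  derivable (\prod_(i <- r | P i) F i) x v.
Proof.
move=> dF; apply: (big_ind (fun f => derivable f x v)) => //.
by move=> f g; exact: derivableM.
Qed.

Lemma is_derive_mulmx p q r
    (A : V -> 'M[R]_(p, q)) (B : V -> 'M[R]_(q, r)) x v :
  derivable A x v -> derivable B x v ->
  is_derive x v (fun y => A y *m B y) ('D_v A x *m B x + A x *m 'D_v B x).
Proof.
move=> dA dB.
have dAij := (derivable_mxP _ _ _).1 dA.
have dBij := (derivable_mxP _ _ _).1 dB.
have E i j : (fun y => (A y *m B y) i j) =
    \sum_k (fun y => A y i k) * (fun y => B y k j).
  by apply/funext => y; rewrite mxE fct_sumE.
have d : derivable (fun y => A y *m B y) x v.
  apply/derivable_mxP => i j; rewrite E; apply: derivable_sum => k.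
  exact: derivableM.
split => //; rewrite derive_mx//; apply/matrixP => i j; rewrite !mxE E.
rewrite derive_sum; last by move=> k; exact: derivableM.
rewrite -big_split/=; apply: eq_bigr => k _.
rewrite deriveM// !derive_mx// !mxE addrC; congr (_ + _).
exact: mulrC.
Qed.

Lemma derivable_det n (A : V -> 'M[R]_n) x v :
  derivable A x v -> derivable (fun y => \det (A y)) x v.
Proof.
move=> dA; have -> : (fun y => \det (A y)) = \sum_(s : 'S_n)
    cst ((-1) ^+ s) * \prod_i (fun y => A y i (s i)).
  by apply/funext => y; rewrite fct_sumE; apply: eq_bigr => s _;
    rewrite !fctE fct_prodE.
apply: derivable_bigsum => s _; apply: derivableM; first exact: derivable_cst.
by apply: derivable_bigprod => i _; exact: ((derivable_mxP _ _ _).1 dA).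
Qed.

Lemma derivable_invmx n (A : V -> 'M[R]_n) x v :
  derivable A x v -> (\forall y \near x, A y \in unitmx) ->
  derivable (fun y => invmx (A y)) x v.
Proof.
move=> dA Aunit.
apply: (@near_eq_derivable _ _ _ (fun y => (\det (A y))^-1 *: \adj (A y))).
  by apply: filterS Aunit => y; rewrite /invmx => ->.
apply/derivable_mxP => i j.
have -> : (fun y => ((\det (A y))^-1 *: \adj (A y)) i j) =
    (fun y => (\det (A y))^-1) * (cst ((-1) ^+ (j + i)) *
      (fun y => \det (row' j (col' i (A y))))).
  by apply/funext => y; rewrite !mxE.
apply: derivableM.
  apply: (@derivableV _ _ (fun y => \det (A y))).
    by have := nbhs_singleton Aunit; rewrite unitmxE unitfE.
  exact: derivable_det.
apply: derivableM; first exact: derivable_cst.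
apply: derivable_det; apply/derivable_mxP => k l.
by under eq_fun do rewrite !mxE; exact: ((derivable_mxP _ _ _).1 dA).
Qed.

End MatrixDerivatives.

(** * Metrics with a closed orthonormal coframe *)

Section ConnectionForm.
Context {R : realType} {n : nat}.
Variable g : 'rV[R]_n -> 'M[R]_n.
Implicit Types (i j k l : 'I_n) (x : 'rV[R]_n).

(** The matrix of the connection in the direction of the [i]-th coordinate: its
[j]-th row holds the components of the covariant derivative of the [j]-th
coordinate field. *)
Definition connection_mx i x : 'M[R]_n :=
  \matrix_(j, m) christoffel g m i j x.

(** Covariant differentiation acts on rows of components as the partial
derivative plus the product by the connection matrix. *)
Lemma nabla_coord_field i (Y : 'rV[R]_n -> 'rV[R]_n) x :
  derivable Y x 'e_i ->
  nabla g (coord_field i) Y x = partial i Y x + Y x *m connection_mx i x.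
Proof.
move=> dY; apply/rowP => m; rewrite !mxE (bigD1 i)//=.
rewrite [X in _ + X]big1; last first.
  by move=> j ji; rewrite mxE eqxx (negbTE ji) mul0r.
rewrite addr0 mxE !eqxx mul1r /partial derive_mx// mxE; congr (_ + _).
by apply: eq_bigr => j _; rewrite mxE mulrC.
Qed.

Lemma nabla_coord_fields i j :
  nabla g (coord_field i) (coord_field j) = fun x => row j (connection_mx i x).
Proof.
apply/funext => x; rewrite nabla_coord_field; last exact: derivable_cst.
by rewrite /partial derive_cst add0r rowE.
Qed.

Lemma lie_bracket_coord_field i j :
  lie_bracket (coord_field i) (coord_field j) = cst (0 : 'rV[R]_n).
Proof.
apply/funext => x; apply/rowP => m; rewrite /cst mxE [RHS]mxE big1// => k _.
by rewrite /partial !derive_cst !mulr0 subrr.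
Qed.

Lemma nabla0 (Y : 'rV[R]_n -> 'rV[R]_n) x : nabla g (cst 0) Y x = 0.
Proof. by apply/rowP => m; rewrite !mxE big1// => i _; rewrite mxE mul0r. Qed.

(** The equality assumed is the vanishing of the curvature in the directions [i]
and [j]. *)
Lemma riemann_eq0 i j k l x :
  derivable (connection_mx i) x 'e_j -> derivable (connection_mx j) x 'e_i ->
  partial i (connection_mx j) x + connection_mx j x *m connection_mx i x =
  partial j (connection_mx i) x + connection_mx i x *m connection_mx j x ->
  riemann g i j k l x = 0.
Proof.
move=> dij dji flat.
have nn a b : derivable (connection_mx b) x 'e_a ->
    nabla g (coord_field a) (nabla g (coord_field b) (coord_field k)) x =
    row k (partial a (connection_mx b) x
      + connection_mx b x *m connection_mx a x).
  move=> dba; rewrite nabla_coord_fields.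
  have [d dE] : is_derive x 'e_a (fun y => row k (connection_mx b y))
      (row k (partial a (connection_mx b) x)).
    under eq_fun do rewrite rowE.
    apply: is_derive_eq (is_derive_mulmx (derivable_cst _ _ _) dba) _.
    by rewrite derive_cst mul0mx add0r rowE.
  apply: etrans (nabla_coord_field d) _.
  apply: etrans (congr1 (+%R^~ _) dE) _.
  by rewrite -row_mul -linearD.
have nL : nabla g (lie_bracket (coord_field i) (coord_field j))
    (coord_field k) x = 0.
  by rewrite lie_bracket_coord_field nabla0.
have sub (a b c r : 'rV[R]_n) : a = r -> b = r -> c = 0 -> a - b - c = 0.
  by move=> -> -> ->; rewrite subr0 subrr.
have V0 := sub _ _ _ _ (nn i j dji)
  (etrans (nn j i dij) (congr1 (row k) (esym flat))) nL.
rewrite /riemann /curvature V0.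
by apply: big1 => a _; apply: big1 => b _; rewrite mxE mulr0 mul0r.
Qed.

End ConnectionForm.

(** A metric with a closed coframe: [E x i a] is the [i]-th component of the
[a]-th of [n] pointwise independent closed one-forms that are orthonormal for
[g], so that [g] is locally the pullback of the Euclidean metric. *)
Section ClosedCoframe.
Context {R : realType} {n : nat}.
Variables (U : set 'rV[R]_n) (g E : 'rV[R]_n -> 'M[R]_n).
Hypotheses (oU : open U)
  (smoothE : forall i a, smooth_on U (fun x => E x i a : R))
  (unitE : forall x, U x -> E x \in unitmx)
  (gE : forall x, U x -> g x = E x *m (E x)^T)
  (closedE : forall x i j a, U x ->
    partial i (fun y => E y j a : R) x = partial j (fun y => E y i a : R) x).
Implicit Types (i j k l a : 'I_n) (x : 'rV[R]_n).

Lemma coframe_derivable x v : U x -> derivable E x v.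
Proof.
by move=> Ux; apply/derivable_mxP => i a;
  exact: (smooth_on_derivable (smoothE i a) Ux).
Qed.

Lemma coframe_partial_entry x i : U x ->
  partial i E x = \matrix_(j, a) partial i (fun y => E y j a : R) x.
Proof.
by move=> Ux; rewrite /partial derive_mx//; exact: coframe_derivable.
Qed.

Lemma coframe_partial_derivable x i v : U x -> derivable (partial i E) x v.
Proof.
move=> Ux; apply/derivable_mxP => j a.
apply: (@near_eq_derivable _ _ _ (partial i (fun y => E y j a : R))).
  by apply: (near_open oU Ux) => y Uy; rewrite coframe_partial_entry// mxE.
exact: (smooth_on_derivable (smooth_on_partial i (smoothE j a)) Ux).
Qed.

Lemma coframe_partial_comm x i j : U x ->
  partial i (partial j E) x = partial j (partial i E) x.
Proof.
move=> Ux; have H a b : partial a (partial b E) x =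
    \matrix_(k, c) partial a (partial b (fun y => E y k c : R)) x.
  rewrite {1}/partial derive_mx; last exact: coframe_partial_derivable.
  apply/matrixP => k c; rewrite !mxE; apply: near_eq_derive.
  by apply: (near_open oU Ux) => y Uy; rewrite coframe_partial_entry// mxE.
apply: etrans (H i j) (etrans _ (esym (H j i))).
apply: eq_mx => k c; exact: (partial_comm oU i j (smoothE k c) Ux).
Qed.

Lemma metric_partial x i j k : U x ->
  partial i (fun y => g y j k : R) x =
  (partial i E x *m (E x)^T + E x *m (partial i E x)^T) j k.
Proof.
move=> Ux; have [d dE] : is_derive x 'e_i (fun y => E y *m (E y)^T)
    (partial i E x *m (E x)^T + E x *m (partial i E x)^T).
  have dT : derivable (fun y => (E y)^T) x 'e_i.
    apply/derivable_mxP => a b; under eq_fun do rewrite mxE.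
    exact: ((derivable_mxP _ _ _).1 (coframe_derivable Ux)).
  apply: is_derive_eq (is_derive_mulmx (coframe_derivable Ux) dT) _.
  congr (_ + _ *m _); rewrite derive_mx// /partial derive_mx; last first.
    exact: coframe_derivable.
  apply/matrixP => a b; rewrite !mxE; congr ('D_('e_i) _ x).
  by apply/funext => y; rewrite mxE.
rewrite -dE derive_mx// mxE; apply: near_eq_derive.
by apply: (near_open oU Ux) => y Uy; rewrite gE.
Qed.

(** The Christoffel symbols in terms of the coframe; this is where closedness
is used. *)
Lemma connection_mx_coframe x i : U x ->
  connection_mx g i x = partial i E x *m invmx (E x).
Proof.
move=> Ux; have Eu := unitE Ux.
have invg : invmx (g x) = (invmx (E x))^T *m invmx (E x).
  have gi : g x *m ((invmx (E x))^T *m invmx (E x)) = 1%:M.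
    rewrite gE// -mulmxA (mulmxA (E x)^T) -trmx_mul mulVmx// trmx1 mul1mx.
    exact: mulmxV.
  have gu : g x \in unitmx by case/mulmx1_unit: gi.
  by rewrite -[RHS](mulKmx gu) gi mulmx1.
(* The lowered Christoffel symbols: the terms that are not derivatives of
   [E y j a] cancel in pairs by closedness. *)
have low j k : 2^-1 * (partial i (fun y => g y k j : R) x
    + partial j (fun y => g y k i : R) x - partial k (fun y => g y i j : R) x) =
    (partial i E x *m (E x)^T) j k.
  pose d a i j := partial i (fun y => E y j a : R) x.
  have dE p q a : partial p E x q a = d a p q.
    by rewrite coframe_partial_entry// mxE.
  have dC a p q : d a p q = d a q p by exact: closedE.
  have dg p q r : partial p (fun y => g y q r : R) x =
      \sum_a (d a p q * E x r a + E x q a * d a p r).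
    rewrite (metric_partial p q r Ux) mxE [X in X + _]mxE [X in _ + X]mxE.
    by rewrite -big_split/=; apply: eq_bigr => a _; rewrite !mxE !dE.
  have -> : (partial i E x *m (E x)^T) j k = \sum_a d a i j * E x k a.
    by rewrite mxE; apply: eq_bigr => a _; rewrite mxE dE.
  rewrite (dg i k j) (dg j k i) (dg k i j) -big_split/= -sumrB mulr_sumr.
  apply: eq_bigr => a _; rewrite (dC a k i) (dC a k j) (dC a j i).
  by move: (d a) => e; field.
apply/matrixP => j m; rewrite mxE /christoffel mulr_sumr.
transitivity ((partial i E x *m (E x)^T *m invmx (g x)) j m).
  rewrite [RHS]mxE; apply: eq_bigr => k _.
  by rewrite -low mulrCA [RHS]mulrC.
rewrite invg mulmxA -(mulmxA _ (E x)^T) -trmx_mul mulVmx// trmx1 mulmx1.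
by [].
Qed.

Lemma connection_mx_derivable x i v : U x -> derivable (connection_mx g i) x v.
Proof.
move=> Ux.
apply: (@near_eq_derivable _ _ _ (fun y => partial i E y *m invmx (E y))).
  by apply: (near_open oU Ux) => y Uy; rewrite connection_mx_coframe.
by have [] := @is_derive_mulmx _ _ _ _ _ _ _ x v
  (@coframe_partial_derivable x i v Ux)
  (derivable_invmx (@coframe_derivable x v Ux) (near_open oU Ux unitE)).
Qed.

(** The derivative of [G_j E = d_j E] in the direction [i]. *)
Lemma curvature_form_coframe x i j : U x ->
  (partial i (connection_mx g j) x + connection_mx g j x *m connection_mx g i x)
    *m E x = partial i (partial j E) x.
Proof.
move=> Ux; have GE y k : U y -> connection_mx g k y *m E y = partial k E y.
  by move=> Uy; rewrite connection_mx_coframe// mulmxKV// unitE.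
have [_ dE] := @is_derive_mulmx _ _ _ _ _ (connection_mx g j) E x 'e_i
  (@connection_mx_derivable x j 'e_i Ux) (@coframe_derivable x 'e_i Ux).
rewrite mulmxDl -mulmxA GE// -[LHS]dE; apply: near_eq_derive.
by apply: (near_open oU Ux) => y Uy; rewrite GE.
Qed.

Lemma riemann_closed_coframe x i j k l : U x -> riemann g i j k l x = 0.
Proof.
move=> Ux; apply: riemann_eq0; try exact: connection_mx_derivable.
apply: (can_inj (mulmxK (unitE Ux))).
apply: etrans (curvature_form_coframe i j Ux) _.
exact: (etrans (coframe_partial_comm i j Ux)
  (esym (curvature_form_coframe j i Ux))).
Qed.

End ClosedCoframe.

(** * Curvature tensors of a flat metric *)

Section FlatMetric.
Context {R : realType} {n : nat}.
Variables (U : set 'rV[R]_n) (g : 'rV[R]_n -> 'M[R]_n).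
Hypotheses (oU : open U)
  (flat : forall x i j k l, U x -> riemann g i j k l x = 0).

Lemma ricci_flat x i j : U x -> ricci g i j x = 0.
Proof.
by move=> Ux; apply: big1 => a _; apply: big1 => b _; rewrite flat// mulr0.
Qed.

Lemma scalar_curvature_flat x : U x -> scalar_curvature g x = 0.
Proof.
move=> Ux; apply: big1 => a _; apply: big1 => b _.
by rewrite ricci_flat// mulr0.
Qed.

Lemma weyl_flat x i j k l : U x -> weyl g i j k l x = 0.
Proof.
move=> Ux; rewrite /weyl flat// !ricci_flat// scalar_curvature_flat//.
by rewrite !mulr0 !subr0 !addr0 mulr0 addr0.
Qed.

Lemma schouten_flat x i j : U x -> schouten g i j x = 0.
Proof.
move=> Ux; rewrite /schouten ricci_flat// scalar_curvature_flat//.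
by rewrite mul0r mul0r subrr mulr0.
Qed.

(** The Schouten tensor vanishes on the whole open set, hence so do its partial
derivatives. *)
Lemma nabla_schouten_flat x i j k : U x -> nabla_schouten g j i k x = 0.
Proof.
move=> Ux; rewrite /nabla_schouten.
rewrite !big1 => [|m _|m _]; try by rewrite schouten_flat// mul0r.
rewrite !subr0 /partial -[RHS](derive_cst (0 : R) x 'e_j).
apply: near_eq_derive.
by apply: (near_open oU Ux) => y Uy; rewrite schouten_flat.
Qed.

Lemma cotton_flat x i j k : U x -> cotton g i j k x = 0.
Proof. by move=> Ux; rewrite /cotton !nabla_schouten_flat// subrr. Qed.

End FlatMetric.

(** * The coframe of a parametrized cylinder *)

(** The index of a coordinate of [R^(m+2)] other than the last one. *)
Definition ord_pad {m} (a : 'I_m.+1) : 'I_m.+2 := widen_ord (leqnSn m.+1) a.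

(** With [n = m + 1], the circle lies in the coordinates [ord_pad ord_max] and
[ord_max]. *)
Lemma cylinderE (R : realType) m (p : 'rV[R]_m.+2) :
  cylinder R m.+1 p <->
  p 0 (ord_pad ord_max) ^+ 2 + p 0 ord_max ^+ 2 = 1.
Proof.
rewrite /cylinder /unit_circle /= !mxE /=.
have -> : inord (m + 0) = ord_pad ord_max :> 'I_m.+2.
  by apply/val_inj; rewrite /= inordK addn0.
by have -> : inord (m + 1) = ord_max :> 'I_m.+2
  by apply/val_inj; rewrite /= inordK addn1.
Qed.

Section CylinderCoframe.
Context {R : realType} {m : nat}.
Variables (U : set 'rV[R]_m.+1) (phi : 'rV[R]_m.+1 -> 'rV[R]_m.+2).
Hypothesis lp : local_param (cylinder R m.+1) U phi.
Implicit Types (i j a : 'I_m.+1) (k : 'I_m.+2) (x : 'rV[R]_m.+1).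

Let oU := lp_open lp.

Definition param_coord k x : R := phi x 0 k.
Local Notation f := param_coord.

Lemma smooth_param_coord k : smooth_on U (f k).
Proof. exact: (smooth_on_coord oU 0 k (lp_smooth lp)). Qed.

Lemma partial_paramE i k x : U x -> partial i phi x 0 k = partial i (f k) x.
Proof.
move=> Ux; rewrite {1}/partial derive_mx ?mxE//.
exact/diff_derivable/(smooth_on_differentiable (lp_smooth lp)).
Qed.

(** The pullback of the angular form of the circle. *)
Definition angular_form i : 'rV[R]_m.+1 -> R :=
  f (ord_pad ord_max) * partial i (f ord_max)
  - f ord_max * partial i (f (ord_pad ord_max)).

(** The row [i] holds the values at [d/dx_i] of the differentials of the linear
coordinates of [phi], followed by the value of the angular form. *)
Definition cylinder_coframe x : 'M[R]_m.+1 := \matrix_(i, a)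
  if a == ord_max then angular_form i x else partial i (f (ord_pad a)) x.

Lemma param_circle x : U x -> f (ord_pad ord_max) x ^+ 2 + f ord_max x ^+ 2 = 1.
Proof. by move=> Ux; apply/cylinderE; apply: (lp_sub lp); exists x. Qed.

Lemma param_circle_tangent i x : U x ->
  f (ord_pad ord_max) x * partial i (f (ord_pad ord_max)) x
  + f ord_max x * partial i (f ord_max) x = 0.
Proof.
move=> Ux; set f0 := f (ord_pad ord_max); set f1 := f ord_max.
have sf k := smooth_param_coord k.
have dM k : is_derive x 'e_i (f k * f k) ((f k x * partial i (f k) x) *+ 2).
  split; first exact: (smooth_on_derivable (smooth_onM oU (sf k) (sf k)) Ux).
  by apply: etrans (partialM i (sf k) (sf k) Ux) _; rewrite mulr2n.
have E : partial i (f0 * f0 + f1 * f1) x = 0.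
  rewrite /partial -[RHS](derive_cst (1 : R) x 'e_i); apply: near_eq_derive.
  apply: (near_open oU Ux) => y Uy.
  by rewrite -(param_circle Uy) !expr2.
have [_ E2] := is_deriveD (dM (ord_pad ord_max)) (dM ord_max).
have := etrans (esym E2) E; rewrite -mulrnDl => /eqP.
by rewrite mulrn_eq0/= => /eqP.
Qed.

(** The differentials of the circle coordinates, [dz_0 = - z_1 w] and
[dz_1 = z_0 w] for the angular form [w]. *)
Lemma partial_param_circle i x : U x ->
  partial i (f (ord_pad ord_max)) x = - f ord_max x * angular_form i x /\
  partial i (f ord_max) x = f (ord_pad ord_max) x * angular_form i x.
Proof.
move=> Ux; have := param_circle_tangent i Ux; have := param_circle Ux.
rewrite /angular_form !fctE.
move: (f _ x) (f _ x) (partial i _ x) (partial i _ x) => s c ds dc cs1 tan.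
split.
- have -> : - s * (c * ds - s * dc) =
      (c ^+ 2 + s ^+ 2) * dc - c * (c * dc + s * ds).
    by ring.
  by rewrite cs1 tan mul1r mulr0 subr0.
- have -> : c * (c * ds - s * dc) =
      (c ^+ 2 + s ^+ 2) * ds - s * (c * dc + s * ds).
    by ring.
  by rewrite cs1 tan mul1r mulr0 subr0.
Qed.

Lemma smooth_angular_form i : smooth_on U (angular_form i).
Proof.
have s k l : smooth_on U (f k * partial i (f l)).
  apply: (smooth_onM oU); first exact: smooth_param_coord.
  exact/smooth_on_partial/smooth_param_coord.
exact: (smooth_onD oU (s _ _) (smooth_onN oU (s _ _))).
Qed.

(** The mixed second derivatives cancel by Clairaut's theorem; what remains is
a combination of [dz_0 /\ dz_1], which is zero since both factors are multiples
of the angular form. *)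
Lemma angular_form_closed i j x : U x ->
  partial i (angular_form j) x = partial j (angular_form i) x.
Proof.
move=> Ux; set f0 := f (ord_pad ord_max); set f1 := f ord_max.
have sf k := smooth_param_coord k.
have spf k a : smooth_on U (partial a (f k)) by exact/smooth_on_partial/sf.
have dE a b : partial a (angular_form b) x =
    f0 x * partial a (partial b f1) x + partial b f1 x * partial a f0 x
    - (f1 x * partial a (partial b f0) x + partial b f0 x * partial a f1 x).
  have dM k l : derivable (f k * partial b (f l)) x 'e_a.
    by apply: (smooth_on_derivable _ Ux); apply: (smooth_onM oU).
  rewrite {1}/partial deriveB//; congr (_ - _).
    exact: (partialM _ (sf _) (spf _ _) Ux).
  exact: (partialM _ (sf _) (spf _ _) Ux).
rewrite (dE i j) (dE j i).
rewrite (partial_comm oU j i (sf ord_max) Ux).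
rewrite (partial_comm oU j i (sf (ord_pad ord_max)) Ux).
have [-> ->] := partial_param_circle i Ux.
have [-> ->] := partial_param_circle j Ux.
move: (partial i (partial j f1) x) (partial i (partial j f0) x) => p q.
move: (angular_form i x) (angular_form j x) (f0 x) (f1 x) => *; ring.
Qed.

Lemma smooth_cylinder_coframe i a :
  smooth_on U (fun x => cylinder_coframe x i a : R).
Proof.
have [aE|aE] := boolP (a == ord_max).
  apply: (smooth_on_congr oU _ (smooth_angular_form i)) => x _.
  by rewrite mxE aE.
apply: (smooth_on_congr oU _
  (smooth_on_partial i (smooth_param_coord (ord_pad a)))).
by move=> x _; rewrite mxE (negbTE aE).
Qed.

Lemma cylinder_coframe_closed x i j a : U x ->
  partial i (fun y => cylinder_coframe y j a : R) x =
  partial j (fun y => cylinder_coframe y i a : R) x.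
Proof.
move=> Ux; have [aE|aE] := boolP (a == ord_max).
  have E b : (fun y => cylinder_coframe y b a : R) = angular_form b.
    by apply/funext => y; rewrite mxE aE.
  by rewrite !E; exact: angular_form_closed.
have E b : (fun y => cylinder_coframe y b a : R) = partial b (f (ord_pad a)).
  by apply/funext => y; rewrite mxE (negbTE aE).
by rewrite !E; exact: (partial_comm oU i j (smooth_param_coord _) Ux).
Qed.

Lemma cylinder_metricE x : U x ->
  induced_metric phi x = cylinder_coframe x *m (cylinder_coframe x)^T.
Proof.
move=> Ux; apply/matrixP => i j; rewrite mxE [RHS]mxE /dot big_ord_recr/=.
rewrite (bigD1 ord_max)//= [RHS](bigD1 ord_max)//= -addrA addrCA addrC.
congr (_ + _).
  rewrite !partial_paramE// !mxE eqxx.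
  have [-> ->] := partial_param_circle i Ux.
  have [-> ->] := partial_param_circle j Ux.
  transitivity ((f (ord_pad ord_max) x ^+ 2 + f ord_max x ^+ 2)
    * (angular_form i x * angular_form j x)).
    2: by rewrite param_circle// mul1r.
  by move: (f _ x) (f _ x) (angular_form i x) (angular_form j x) => *; ring.
apply: eq_bigr => a /negbTE aE.
by rewrite !partial_paramE// !mxE aE.
Qed.

(** The rows of the Jacobian are linear images of those of the coframe, so that
a vector in the kernel of the coframe is in that of the Jacobian. *)
Lemma cylinder_coframe_unit x : U x -> cylinder_coframe x \in unitmx.
Proof.
move=> Ux; rewrite -row_free_unit; apply/inj_row_free => v vE.
have vEa a : \sum_i v 0 i * cylinder_coframe x i a = 0.
  by move/rowP: vE => /(_ a); rewrite !mxE.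
have vomega : \sum_i v 0 i * angular_form i x = 0.
  by rewrite -[RHS](vEa ord_max); apply: eq_bigr => i _; rewrite mxE eqxx.
have Jrow i k : 'J phi x i k = partial i (f k) x.
  rewrite -partial_paramE// /partial deriveEjacobian; last first.
    exact: (smooth_on_differentiable (lp_smooth lp)).
  by rewrite -rowE [RHS]mxE.
suff vJ : v *m 'J phi x = 0.
  have := lp_immersion lp Ux => /row_free_inj; apply.
  by rewrite vJ mul0mx.
apply/rowP => k; rewrite !mxE.
have circ c : \sum_i v 0 i * (c * angular_form i x) = 0.
  by under eq_bigr do rewrite mulrCA; rewrite -mulr_sumr vomega mulr0.
have [a kE|->] := unliftP ord_max k; last first.
  rewrite -[RHS](circ (f (ord_pad ord_max) x)); apply: eq_bigr => i _.
  by rewrite Jrow; have [_ ->] := partial_param_circle i Ux.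
have {kE}-> : k = ord_pad a by apply/val_inj; rewrite kE; exact: lift_max.
have [->|/negbTE aE] := eqVneq a ord_max.
  rewrite -[RHS](circ (- f ord_max x)); apply: eq_bigr => i _.
  by rewrite Jrow; have [-> _] := partial_param_circle i Ux.
by rewrite -[RHS](vEa a); apply: eq_bigr => i _; rewrite Jrow mxE aE.
Qed.

Lemma riemann_cylinder x i j (k l : 'I_m.+1) : U x ->
  riemann (induced_metric phi) i j k l x = 0.
Proof.
apply: (riemann_closed_coframe oU smooth_cylinder_coframe).
- exact: cylinder_coframe_unit.
- exact: cylinder_metricE.
- exact: cylinder_coframe_closed.
Qed.

End CylinderCoframe.

(** * Charts of the cylinder *)

Lemma is_derive_scalel (R : realType) (V W : normedModType R) (k : V -> R)
    (w : W) (x v : V) (dk : R) :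
  is_derive x v k dk -> is_derive x v (fun y => k y *: w) (dk *: w).
Proof.
move=> [dkx <-].
have c : (fun h => h^-1 *: (((fun y => k y *: w) \o shift x) (h *: v) - k x *: w))
    @ 0^' --> 'D_v k x *: w.
  have -> : (fun h => h^-1 *: (((fun y => k y *: w) \o shift x) (h *: v) - k x *: w))
      = (fun h => (h^-1 *: ((k \o shift x) (h *: v) - k x)) *: w).
    by apply/funext => h /=; rewrite -scalerBl scalerA.
  exact: cvgZr_tmp dkx.
by split; [apply/cvg_ex; exists ('D_v k x *: w)|exact: cvg_lim c].
Qed.

Lemma continuous_mx (R : realType) (T : topologicalType) p q
    (M : T -> 'M[R]_(p, q)) (t : T) :
  (forall i j, (M s i j : R) @[s --> t] --> M t i j) ->
  {for t, continuous M}.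
Proof.
move=> cM; apply/cvgrPdist_le => /= e e0; near=> s.
rewrite /Num.Def.normr/= mx_normrE (bigmax_le _ (ltW e0))//= => i _.
rewrite !mxE/=; move: i; near: s; apply: filter_forall => /= i.
exact: ((cvgrPdist_le _ _).1 (cM i.1 i.2)).
Unshelve. all: by end_near. Qed.

Section SeparatedTrig.
Context {R : realType} {n : nat} {W : normedModType R}.
Implicit Types (i l : 'I_n) (x : 'rV[R]_n) (t : R).

(** A family of curves in [W] closed under differentiation. *)
Definition trig_curve (r u v w : W) t : W :=
  t *: r + cos t *: u + sin t *: v + w.

Lemma is_derive_trig_curve (r u v w : W) t :
  is_derive t 1 (trig_curve r u v w) (trig_curve 0 v (- u) r t).
Proof.
apply: is_derive_eq (is_deriveD (is_deriveD (is_deriveD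
  (is_derive_scalel r (is_derive_id t 1))
  (is_derive_scalel u (is_derive_cos t)))
  (is_derive_scalel v (is_derive_sin t))) (is_derive_cst w t 1)) _.
rewrite /trig_curve scaler0 add0r addr0 scale1r scaleNr scalerN.
by rewrite addrC [r + _]addrC addrA.
Qed.

(** Sums of curves of the above kind, one for each coordinate. *)
Definition sep_trig (r u v w : 'I_n -> W) x : W :=
  \sum_l trig_curve (r l) (u l) (v l) (w l) (x 0 l).

Lemma is_derive_coord_comp (c : R -> W) (dc : W) i l x :
  is_derive (x 0 l) 1 c dc ->
  is_derive x 'e_i (fun y : 'rV[R]_n => c (y 0 l)) (if l == i then dc else 0).
Proof.
have [-> [dcx dcE]|li _] := eqVneq l i; last first.
  have E : (fun h : R => h^-1 *: (((fun y : 'rV[R]_n => c (y 0 l)) \o shift x)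
      (h *: 'e_i) - c (x 0 l))) = cst 0.
    by apply/funext => h /=; rewrite !mxE eqxx (negbTE li) mulr0 add0r
      subrr scaler0.
  split; rewrite /derivable /derive E; first exact: is_cvg_cst.
  exact: lim_cst.
have E : (fun h : R => h^-1 *: (((fun y : 'rV[R]_n => c (y 0 i)) \o shift x)
    (h *: 'e_i) - c (x 0 i))) =
    (fun h : R => h^-1 *: ((c \o shift (x 0 i)) (h *: 1) - c (x 0 i))).
  by apply/funext => h /=; rewrite !mxE !eqxx.
by split; rewrite /derivable /derive E.
Qed.

Lemma differentiable_sep_trig r u v w x : differentiable (sep_trig r u v w) x.
Proof.
rewrite (_ : sep_trig r u v w = \sum_l (fun y : 'rV[R]_n =>
  trig_curve (r l) (u l) (v l) (w l) (y 0 l))); last first.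
  by apply/funext => y; rewrite fct_sumE.
apply: differentiable_sum => l.
apply: (differentiable_comp (f := fun y : 'rV[R]_n => y 0 l : R)).
  exact: differentiable_coord.
by apply/derivable1_diffP; have [] :=
  is_derive_trig_curve (r l) (u l) (v l) (w l) (x 0 l).
Qed.

Lemma partial_sep_trig r u v w i x : partial i (sep_trig r u v w) x =
  trig_curve 0 (v i) (- u i) (r i) (x 0 i).
Proof.
rewrite (_ : sep_trig r u v w = \sum_l (fun y : 'rV[R]_n =>
  trig_curve (r l) (u l) (v l) (w l) (y 0 l))); last first.
  by apply/funext => y; rewrite fct_sumE.
have [_ E] := is_derive_sum (fun l => is_derive_coord_comp i
  (is_derive_trig_curve (r l) (u l) (v l) (w l) (x 0 l))).
by rewrite /partial E -big_mkcond/= big_pred1_eq.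
Qed.

Lemma smooth_sep_trig (U : set 'rV[R]_n) (oU : open U) r u v w :
  smooth_on U (sep_trig r u v w).
Proof.
pose C f := exists r u v w, f = sep_trig r u v w.
apply: (@smooth_on_coind _ _ _ oU _ C); last by exists r, u, v, w.
  by move=> _ x [? [? [? [? ->]]]] _; exact: differentiable_sep_trig.
move=> _ i [{}r [{}u [{}v [{}w ->]]]].
pose d (a : 'I_n -> W) l := if l == i then a l else 0.
exists (sep_trig (cst 0) (d v) (d (- u)) (d r)); first by do 4 eexists.
move=> x _; rewrite partial_sep_trig /sep_trig (bigD1 i)//= big1 ?addr0.
  by rewrite /d eqxx.
by move=> l /negbTE li; rewrite /d li /trig_curve !scaler0 !addr0.
Qed.

End SeparatedTrig.

Section CylinderChart.
Context {R : realType} {m : nat}.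
Variables a b : R.
Hypothesis ab1 : a ^+ 2 + b ^+ 2 = 1.
Implicit Types (i : 'I_m.+1) (x : 'rV[R]_m.+1) (z : 'rV[R]_m.+2).

Local Notation c0 := (ord_pad (ord_max : 'I_m.+1)).
Local Notation c1 := (ord_max : 'I_m.+2).

(** The map to the cylinder whose last coordinate is the angle measured from
the point [(a, b)] of the circle; it is a chart on [cyl_chart_dom]. *)
Definition cyl_chart : 'rV[R]_m.+1 -> 'rV[R]_m.+2 :=
  sep_trig (fun i => if i == ord_max then 0 else 'e_(ord_pad i))
    (fun i => if i == ord_max then a *: 'e_c0 + b *: 'e_c1 else 0)
    (fun i => if i == ord_max then - b *: 'e_c0 + a *: 'e_c1 else 0)
    (fun=> 0).

Definition cyl_chart_dom : set 'rV[R]_m.+1 :=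
  [set x | - (pi / 2) < x 0 ord_max < pi / 2].

(** The coordinates of the circle component of [z] in the orthonormal basis
[(a, b)], [(- b, a)]. *)
Definition rot_cos z : R := a * z 0 c0 + b * z 0 c1.
Definition rot_sin z : R := a * z 0 c1 - b * z 0 c0.

(** The inverse of the chart, extended to the ambient space. *)
Definition cyl_chart_inv z : 'rV[R]_m.+1 :=
  \row_i if i == ord_max then asin (rot_sin z) else z 0 (ord_pad i).

Lemma ord_padF i : (ord_pad i == c1) = false.
Proof. by apply/negbTE; rewrite -val_eqE/= neq_ltn ltn_ord. Qed.

Lemma ord_pad_eq i j : (ord_pad i == ord_pad j) = (i == j).
Proof. by []. Qed.

(** Case analysis on an index: linear coordinate, or first or second coordinate
of the circle. *)
Lemma ord_padP (P : 'I_m.+2 -> Prop) :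
  (forall i, i != ord_max -> P (ord_pad i)) -> P c0 -> P c1 -> forall k, P k.
Proof.
move=> Ppad P0 P1 k; have [j ->|->//] := unliftP ord_max k.
have -> : lift ord_max j = ord_pad j by apply/val_inj; exact: lift_max.
by have [->|/Ppad] := eqVneq j ord_max.
Qed.

Lemma cyl_chart_coord x k : cyl_chart x 0 k =
  cos (x 0 ord_max) * (a * (k == c0)%:R + b * (k == c1)%:R) +
  sin (x 0 ord_max) * (- b * (k == c0)%:R + a * (k == c1)%:R) +
  \sum_(i < m.+1 | i != ord_max) x 0 i * (k == ord_pad i)%:R.
Proof.
rewrite /cyl_chart /sep_trig summxE (bigD1 ord_max)//= eqxx; congr (_ + _).
  by rewrite /trig_curve scaler0 add0r addr0 !mxE eqxx/=.
apply: eq_bigr => i /negbTE ->.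
by rewrite /trig_curve !scaler0 !addr0 !mxE eqxx.
Qed.

Lemma cyl_chart_pad x i : i != ord_max -> cyl_chart x 0 (ord_pad i) = x 0 i.
Proof.
move=> imax; rewrite cyl_chart_coord (bigD1 i)//= big1 => [|j /andP[_ ji]].
  by rewrite !ord_pad_eq (negbTE imax) ord_padF eqxx/=; ring.
by rewrite ord_pad_eq eq_sym (negbTE ji) mulr0.
Qed.

Lemma cyl_chart_c0 x :
  cyl_chart x 0 c0 = a * cos (x 0 ord_max) - b * sin (x 0 ord_max).
Proof.
rewrite cyl_chart_coord big1 => [|j jmax].
  by rewrite ord_padF eqxx/=; ring.
by rewrite ord_pad_eq eq_sym (negbTE jmax) mulr0.
Qed.

Lemma cyl_chart_c1 x :
  cyl_chart x 0 c1 = b * cos (x 0 ord_max) + a * sin (x 0 ord_max).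
Proof.
rewrite cyl_chart_coord big1 => [|j jmax].
  by rewrite eq_sym ord_padF eqxx/=; ring.
by rewrite eq_sym ord_padF mulr0.
Qed.

Lemma rot_cos_chart x : rot_cos (cyl_chart x) = cos (x 0 ord_max).
Proof.
rewrite /rot_cos cyl_chart_c0 cyl_chart_c1 -[RHS]mul1r -ab1; ring.
Qed.

Lemma rot_sin_chart x : rot_sin (cyl_chart x) = sin (x 0 ord_max).
Proof.
rewrite /rot_sin cyl_chart_c0 cyl_chart_c1 -[RHS]mul1r -ab1; ring.
Qed.

Lemma rotK z : z 0 c0 = a * rot_cos z - b * rot_sin z /\
  z 0 c1 = b * rot_cos z + a * rot_sin z.
Proof.
by split; rewrite -[LHS]mul1r -ab1 /rot_cos /rot_sin; ring.
Qed.

Lemma rot_circle z :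
  rot_cos z ^+ 2 + rot_sin z ^+ 2 = z 0 c0 ^+ 2 + z 0 c1 ^+ 2.
Proof. by rewrite -[RHS]mul1r -ab1 /rot_cos /rot_sin; ring. Qed.

Lemma cyl_chart_in x : cylinder R m.+1 (cyl_chart x).
Proof.
by apply/cylinderE; rewrite -rot_circle rot_cos_chart rot_sin_chart cos2Dsin2.
Qed.

Lemma cyl_chartK : {in cyl_chart_dom, cancel cyl_chart cyl_chart_inv}.
Proof.
move=> x /set_mem /andP[xl xr]; apply/rowP => i; rewrite mxE.
have [->|imax] := eqVneq i ord_max; last exact: cyl_chart_pad.
by rewrite rot_sin_chart sinK// in_itv/= !ltW.
Qed.

Lemma cyl_chart_invK z : cylinder R m.+1 z -> 0 < rot_cos z ->
  cyl_chart (cyl_chart_inv z) = z.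
Proof.
move=> /cylinderE; rewrite -rot_circle => circ cz.
have sz : -1 <= rot_sin z <= 1.
  by rewrite -ler_norml -(@expr_le1 _ 2)// real_normK ?num_real// -circ
    lerDr sqr_ge0.
have cE : cos (asin (rot_sin z)) = rot_cos z.
  by rewrite cos_asin// -circ addrK sqrtr_sqr gtr0_norm.
have sE : sin (asin (rot_sin z)) = rot_sin z by rewrite asinK.
apply/rowP; apply: ord_padP => [i imax||].
- by rewrite cyl_chart_pad// mxE (negbTE imax).
- by rewrite cyl_chart_c0 mxE eqxx cE sE; have [] := rotK z.
- by rewrite cyl_chart_c1 mxE eqxx cE sE; have [] := rotK z.
Qed.

Lemma continuous_rot_cos : continuous rot_cos.
Proof.
move=> z; exact: (cvgD (cvgM (cvg_cst a) (@coord_continuous R 1 m.+2 0 c0 z))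
  (cvgM (cvg_cst b) (@coord_continuous R 1 m.+2 0 c1 z))).
Qed.

Lemma continuous_rot_sin : continuous rot_sin.
Proof.
move=> z; exact: (cvgB (cvgM (cvg_cst a) (@coord_continuous R 1 m.+2 0 c1 z))
  (cvgM (cvg_cst b) (@coord_continuous R 1 m.+2 0 c0 z))).
Qed.

Lemma continuous_cyl_chart_inv z : -1 < rot_sin z < 1 ->
  {for z, continuous cyl_chart_inv}.
Proof.
move=> sz; apply: continuous_mx => k i.
rewrite mxE; under eq_fun do rewrite mxE.
case: ifP => _; last exact: coord_continuous.
exact: (continuous_comp (@continuous_rot_sin z) (continuous_asin sz)).
Qed.

Lemma open_cyl_chart_dom : open cyl_chart_dom.
Proof.
rewrite (_ : cyl_chart_dom =
  (fun x => x 0 ord_max : R) @^-1` `]- (pi / 2), pi / 2[); last first.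
  by apply/seteqP; split => x; rewrite /cyl_chart_dom /= in_itv.
by apply: open_comp => // x _; exact: coord_continuous.
Qed.

(** The ambient open set consists of the points with [-1 < rot_sin z < 1], near
which [cyl_chart_inv] is continuous, with [0 < rot_cos z], and with image in [V]
under [cyl_chart_inv]. *)
Lemma cyl_chart_homeo (V : set 'rV[R]_m.+1) : open V -> V `<=` cyl_chart_dom ->
  exists2 W, open W & cyl_chart @` V = cylinder R m.+1 `&` W.
Proof.
move=> oV Vdom.
exists [set z | [/\ -1 < rot_sin z < 1, 0 < rot_cos z & V (cyl_chart_inv z)]].
  rewrite openE => z /= [sz cz Vz].
  have nV : \forall y \near z, V (cyl_chart_inv y).
    exact: (continuous_cyl_chart_inv sz (open_nbhs_nbhs (conj oV Vz))).
  have nc : \forall y \near z, 0 < rot_cos y.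
    exact: (cvgr_gt _ (@continuous_rot_cos z)).
  have ns : \forall y \near z, -1 < rot_sin y < 1.
    have /andP[s1 s2] := sz; near=> y; apply/andP; split; near: y.
      exact: (cvgr_gt _ (@continuous_rot_sin z)).
    exact: (cvgr_lt _ (@continuous_rot_sin z)).
  by near=> y; split; near: y.
apply/seteqP; split => [_ [x Vx <-]|z [Sz [sz cz Vz]]].
  have xdom := Vdom x Vx; split; first exact: cyl_chart_in.
  rewrite /= rot_cos_chart rot_sin_chart cyl_chartK ?inE//.
  have cos_gt0 : 0 < cos (x 0 ord_max) by exact: cos_gt0_pihalf.
  split => //; rewrite -ltr_norml -(@expr_lt1 _ 2)// real_normK ?num_real//.
  rewrite sin2cos2 ltrBlDr ltrDl.
  by rewrite exprn_gt0.
by exists (cyl_chart_inv z) => //; exact: cyl_chart_invK.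
Unshelve. all: by end_near. Qed.

Lemma cyl_chart_jacobian x i k : 'J cyl_chart x i k =
  (trig_curve 0 (if i == ord_max then - b *: 'e_c0 + a *: 'e_c1 else 0)
    (- (if i == ord_max then a *: 'e_c0 + b *: 'e_c1 else 0))
    (if i == ord_max then 0 else 'e_(ord_pad i)) (x 0 i) : 'rV[R]_m.+2) 0 k.
Proof.
transitivity (partial i cyl_chart x 0 k).
  rewrite /partial deriveEjacobian; last exact: differentiable_sep_trig.
  by rewrite -rowE [RHS]mxE.
by rewrite /cyl_chart partial_sep_trig.
Qed.

Lemma cyl_chart_immersion x : row_free ('J cyl_chart x).
Proof.
apply/inj_row_free => v /rowP vJ.
set t := x 0 ord_max; set w := v 0 ord_max.
have vJk k : w * (cos t * (- b * (k == c0)%:R + a * (k == c1)%:R)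
      - sin t * (a * (k == c0)%:R + b * (k == c1)%:R)) +
    \sum_(i < m.+1 | i != ord_max) v 0 i * (k == ord_pad i)%:R = 0.
  have := vJ k; rewrite mxE [RHS]mxE (bigD1 ord_max)//= => vJk.
  apply: etrans vJk; congr (_ + _).
    rewrite cyl_chart_jacobian eqxx /trig_curve !mxE eqxx/= -/t -/w; ring.
  apply: eq_bigr => i /negbTE imax; rewrite cyl_chart_jacobian imax.
  by rewrite /trig_curve oppr0 !scaler0 !add0r mxE eqxx.
have v_pad i : i != ord_max -> v 0 i = 0.
  move=> imax; have := vJk (ord_pad i).
  rewrite ord_padF ord_pad_eq (negbTE imax).
  rewrite !mulr0 addr0 !mulr0 subrr mulr0 add0r.
  rewrite (bigD1 i)//= big1 => [|j /andP[_ ji]].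
    by rewrite eqxx mulr1 addr0.
  by rewrite ord_pad_eq eq_sym (negbTE ji) mulr0.
have sum0 k : \sum_(i < m.+1 | i != ord_max) v 0 i * (k == ord_pad i)%:R = 0.
  by apply: big1 => i imax; rewrite v_pad// mul0r.
have w0 : w = 0.
  have := vJk c0; rewrite sum0 addr0 ord_padF eqxx/= => e0.
  have := vJk c1; rewrite sum0 addr0 eq_sym ord_padF eqxx/= => e1.
  (* [e0] and [e1] say that [w] times a vector of norm 1 is zero *)
  have -> : w = w * ((a ^+ 2 + b ^+ 2) * (cos t ^+ 2 + sin t ^+ 2)).
    by rewrite ab1 cos2Dsin2 !mulr1.
  have -> : w * ((a ^+ 2 + b ^+ 2) * (cos t ^+ 2 + sin t ^+ 2)) =
      (- b * cos t - a * sin t) *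
        (w * (cos t * (- b * 1 + a * 0) - sin t * (a * 1 + b * 0)))
      + (a * cos t - b * sin t) *
        (w * (cos t * (- b * 0 + a * 1) - sin t * (a * 0 + b * 1))).
    by ring.
  by rewrite e0 e1 !mulr0 addr0.
apply/rowP => i; rewrite [RHS]mxE.
by have [->|/v_pad] := eqVneq i ord_max.
Qed.

Lemma cyl_chart_local_param :
  local_param (cylinder R m.+1) cyl_chart_dom cyl_chart.
Proof.
split.
- exact: open_cyl_chart_dom.
- exact: (smooth_sep_trig open_cyl_chart_dom).
- by move=> _ [x _ <-]; exact: cyl_chart_in.
- by move=> x _; exact: cyl_chart_immersion.
- by move=> x y xU yU xy; rewrite -(cyl_chartK xU) xy cyl_chartK.
- exact: cyl_chart_homeo.
Qed.

End CylinderChart.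

Lemma hypersurface_cylinder (R : realType) m :
  hypersurface (cylinder R m.+1).
Proof.
move=> p /cylinderE p1.
pose a := p 0 (ord_pad ord_max); pose b := p 0 ord_max.
exists (cyl_chart_dom (R := R) (m := m)), (cyl_chart a b); split.
  exact: cyl_chart_local_param.
pose x : 'rV[R]_m.+1 :=
  \row_i if i == ord_max then 0 else p 0 (ord_pad i).
have x0 : x 0 ord_max = 0 by rewrite mxE eqxx.
have pi0 : 0 < pi / 2 :> R by have /andP[] := @pihalf_02 R.
exists x; first by rewrite /cyl_chart_dom/= x0 oppr_lt0 pi0.
apply/rowP; apply: ord_padP => [i imax||].
- by rewrite cyl_chart_pad// mxE (negbTE imax).
- by rewrite cyl_chart_c0 x0 cos0 sin0 mulr1 mulr0 subr0.
- by rewrite cyl_chart_c1 x0 cos0 sin0 mulr1 mulr0 addr0.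
Qed.

Theorem mainTheorem4 (R : realType) (n : nat) (hn : (3 <= n)%N) :
  conformally_flat (cylinder R n).
Proof.
case: n hn => // m _; split; first exact: hypersurface_cylinder.
move=> U phi lp x Ux.
have oU := lp_open lp.
split=> [_ i j k|_ i j k l].
  by apply: (cotton_flat oU) Ux => y *; exact: (riemann_cylinder lp).
by apply: weyl_flat Ux => y *; exact: (riemann_cylinder lp).
Qed.
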